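(* For every finite simple bipartite graph $G$ with at least one vertex, $$\mathrm{cub}(G) \le 2\left(\mathrm{box}(G) + \lceil \log_2 \alpha(G) \rceil\right),$$ where $\alpha(G)$ is the cardinality of a maximum independent set of $G$.
   Context: An axis-parallel $k$-dimensional box ($k$-box) is a Cartesian product $R_1\times\cdots\times R_k$ of closed intervals $R_i=[a_i,b_i]$ of the real line; a $k$-unit-cube ($k$-cube) is a $k$-box in which each $R_i$ has the form $[a_i,a_i+1]$. A $k$-box representation (respectively $k$-cube representation) of a graph $G$ is a map $f$ from $V(G)$ to $k$-boxes (respectively $k$-cubes) such that for any two distinct vertices $u,v$, $(u,v)\in E(G)$ if and only if $f(u)\cap f(v)\neq\emptyset$. The boxicity $\mathrm{box}(G)$ (respectively cubicity $\mathrm{cub}(G)$) is the minimum non-negative integer $k$ such that $G$ has a $k$-box representation (respectively $k$-cube representation). By convention, the graphs with boxicity (cubicity) $0$ are exactly the complete graphs. *)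

(* Defs.v *)
From HB Require Import structures.
From mathcomp Require Import all_boot all_order all_algebra.
From mathcomp Require Import boolp classical_sets reals.
From mathcomp Require Import lra.

Set Implicit Arguments.
Unset Strict Implicit.
Unset Printing Implicit Defensive.

Import Order.TTheory GRing.Theory Num.Theory.

Local Open Scope classical_set_scope.
Local Open Scope ring_scope.

Record sgraph := SGraph {
  vertex :> finType;
  edge : rel vertex;
  edge_sym : symmetric edge;
  edge_irrefl : irreflexive edge }.

Definition bipartite (G : sgraph) : Prop :=
  exists A : {set G}, forall u v : G, edge u v -> (u \in A) != (v \in A).

Definition independent (G : sgraph) (S : {set G}) : bool :=
  [forall u in S, forall v in S, ~~ edge u v].

Definition alpha (G : sgraph) : nat :=
  (\max_(S : {set G} | independent S) #|S|)%N.

Section Representations.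
Variable R : realType.

(* Points of R^k are functions 'I_k -> R, so that R^0 is a single point and
   the only 0-box is R^0 itself; thus 0-representable means complete. *)
Definition box_of k (a b : 'I_k -> R) : set ('I_k -> R) :=
  [set x | forall i, x i \in `[a i, b i]].

Definition is_box k (B : set ('I_k -> R)) : Prop :=
  exists a b : 'I_k -> R, (forall i, a i <= b i) /\ B = box_of a b.

Definition is_cube k (B : set ('I_k -> R)) : Prop :=
  exists a : 'I_k -> R, B = box_of a (fun i => a i + 1).

Definition intersection_rep (G : sgraph) k (f : G -> set ('I_k -> R)) : Prop :=
  forall u v : G, u != v -> (edge u v <-> f u `&` f v !=set0).

Definition has_box_rep (G : sgraph) (k : nat) : Prop :=
  exists f : G -> set ('I_k -> R),
    (forall v, is_box (f v)) /\ intersection_rep f.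

Definition has_cube_rep (G : sgraph) (k : nat) : Prop :=
  exists f : G -> set ('I_k -> R),
    (forall v, is_cube (f v)) /\ intersection_rep f.

(* One coordinate per vertex w: w gets [0,1], its neighbours [1,2] and all
   other vertices [2,3]. *)
Lemma ex_cube_rep (G : sgraph) : exists k, `[< has_cube_rep G k >].
Proof.
exists #|G|; apply/asboolP.
pose a (u : G) (i : 'I_#|G|) : R :=
  if u == enum_val i then 0 else if edge u (enum_val i) then 1 else 2.
exists (fun u => box_of (a u) (fun i => a u i + 1)); split=> [v|u v uv].
  by exists (a v).
split=> [euv|[x [xu xv]]].
  have near_uv i : (a v i <= a u i + 1) && (a u i <= a v i + 1).
    rewrite /a; case: (eqVneq u (enum_val i)) => [ui|_].
      by rewrite -ui eq_sym (negbTE uv) (edge_sym v) euv; lra.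
    case: (eqVneq v (enum_val i)) => [vi|_]; last by do 2!case: ifP => _; lra.
    by rewrite -vi euv; lra.
  exists (fun i => Num.max (a u i) (a v i)); split=> i; rewrite in_itv /=;
    have /andP[vu uv'] := near_uv i; rewrite le_max ge_max lexx ?orbT /=;
    by rewrite ?vu ?uv' ?lerDl ler01.
apply: contrapT => /negP nuv.
have := xu (enum_rank u); have := xv (enum_rank u).
rewrite !in_itv /= /a enum_rankK eqxx eq_sym (negbTE uv) edge_sym (negbTE nuv).
lra.
Qed.

Lemma ex_box_rep (G : sgraph) : exists k, `[< has_box_rep G k >].
Proof.
have [k /asboolP[f [fc fr]]] := ex_cube_rep G.
exists k; apply/asboolP; exists f; split=> // v.
have [a ->] := fc v; exists a, (fun i => a i + 1); split=> // i; lra.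
Qed.

Definition boxicity (G : sgraph) : nat := ex_minn (ex_box_rep G).

Definition cubicity (G : sgraph) : nat := ex_minn (ex_cube_rep G).

End Representations.

(* Main.v *)
Require Import Defs.
From mathcomp Require Import all_boot all_order all_algebra.
From mathcomp Require Import boolp classical_sets reals.
From mathcomp Require Import lra.

(** A cube representation is a family of real coordinates on the vertices in
    which two distinct vertices are adjacent iff every coordinate moves by at
    most 1 between them. So every coordinate has to respect all edges, and
    every non-edge has to be separated by at least one coordinate.

    Let [A] and its complement be the two sides of the bipartite graph, and fix
    a box representation of dimension [k]. For each side [S] there are two
    families of coordinates.

    - Non-edges inside [S]: as [S] is independent, its vertices can be given
      distinct binary words of length [up_log 2 (alpha G)]. For each position of
      the word, put [S] at 0 or 2 according to the bit, and the other side at 1.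
      Edges run between the two sides, so they are respected, and two vertices
      of [S] are separated at a position where their words differ
      ([bit_coord]).

    - Non-edges between the sides: two boxes are disjoint iff, in some direction
      [i], the interval of one ends before that of the other begins. After
      shrinking all endpoints to absolute value at most 1/2, put a vertex of
      [S] at its right endpoint, and a vertex [v] of the other side at 1 plus
      its left endpoint.
      The distance between [u] in [S] and such a [v] exceeds 1 exactly when
      the interval of [u] ends before that of [v] begins; the other order is
      covered by exchanging the sides ([box_coord]).

    This makes [2 * (k + up_log 2 (alpha G))] coordinates. *)

Set Implicit Arguments.
Unset Strict Implicit.
Unset Printing Implicit Defensive.

Import Order.TTheory GRing.Theory Num.Theory.

Local Open Scope classical_set_scope.
Local Open Scope ring_scope.

Lemma boxes_meetP (R : realType) k (a b c d : 'I_k -> R) :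
  (forall i, a i <= b i) -> (forall i, c i <= d i) ->
  (box_of a b `&` box_of c d !=set0 <->
   forall i, (a i <= d i) && (c i <= b i)).
Proof.
move=> ab cd; split=> [[x [xab xcd]] i|near].
  have := xab i; have := xcd i; rewrite !in_itv /=; lra.
(* The larger of the two left endpoints lies in both intervals. *)
exists (fun i => Num.max (a i) (c i)); split=> i; rewrite in_itv /=;
  have /andP[ad cb] := near i;
  by rewrite le_max ge_max lexx ?orbT /= ?ab ?cd ?ad ?cb.
Qed.

Lemma finite_family_bounded (R : realType) (T : finType) (x : T -> R) :
  exists2 M : R, 0 < M & forall t, `|x t| <= M.
Proof.
exists (1 + \sum_t `|x t|) => [|t]; first by rewrite ltr_pwDl ?sumr_ge0.
by rewrite (bigD1 t) //= addrCA lerDl addr_ge0 // sumr_ge0.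
Qed.

(** The graph is finite, so all the endpoints can be scaled down into a short
    interval; the bound 1/2 keeps any two of them within distance 1. *)
Lemma box_rep_small (R : realType) (G : sgraph) k :
  has_box_rep R G k ->
  exists l r : G -> 'I_k -> R,
    [/\ forall v i, `|l v i| <= 2^-1, forall v i, `|r v i| <= 2^-1 &
        forall u v, u != v ->
          (edge u v <-> forall i, (l u i <= r v i) && (l v i <= r u i))].
Proof.
move=> [f [fbox frep]].
have /choice[ab abP] : forall v, exists p : ('I_k -> R) * ('I_k -> R),
    (forall i, p.1 i <= p.2 i) /\ f v = box_of p.1 p.2.
  by move=> v; have [a [b ?]] := fbox v; exists (a, b).
pose x (t : G * 'I_k * bool) :=
  if t.2 then (ab t.1.1).1 t.1.2 else (ab t.1.1).2 t.1.2.
have [M M0 xM] := finite_family_bounded x.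
pose c := (2 * M)^-1; have c0 : 0 < c by rewrite invr_gt0 mulr_gt0.
have cx t : `|c * x t| <= 2^-1.
  rewrite normrM gtr0_norm // /c invfM -mulrA ger_pMr ?invr_gt0 //.
  by rewrite mulrC ler_pdivrMr // mul1r.
exists (fun v i => c * x (v, i, true)), (fun v i => c * x (v, i, false)).
split=> // u v uv.
have [uab fu] := abP u; have [vab fv] := abP v.
have := frep u v uv; rewrite fu fv boxes_meetP // => ->.
by split=> near i; have := near i; rewrite /x /= !ler_pM2l.
Qed.

(** A cube is determined by its corner, and two unit intervals meet iff their
    left endpoints are within distance 1. An arbitrary finite index type lets
    coordinates be indexed by what they are for rather than by a number. *)
Lemma cube_rep_of_coords (R : realType) (G : sgraph) (T : finType)
    (x : T -> G -> R) :
  (forall u v, u != v -> (edge u v <-> forall t, `|x t u - x t v| <= 1)) ->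
  has_cube_rep R G #|T|.
Proof.
move=> xP; pose a v (i : 'I_#|T|) := x (enum_val i) v.
exists (fun v => box_of (a v) (fun i => a v i + 1)).
split=> [v|u v uv]; first by exists (a v).
rewrite xP // boxes_meetP; try by move=> i; rewrite lerDl.
split=> near => [i|t].
  by have := near (enum_val i); rewrite ler_norml /a; lra.
by have := near (enum_rank t); rewrite /a enum_rankK ler_norml; lra.
Qed.

Lemma card_le_alpha (G : sgraph) (S : {set G}) :
  independent S -> (#|S| <= alpha G)%N.
Proof. exact: (@leq_bigmax_cond _ (@independent G) (fun T => #|T|)). Qed.

Lemma ex_binary_words (T : finType) (S : {set T}) m : (#|S| <= 2 ^ m)%N ->
  exists w : T -> {ffun 'I_m -> bool}, {in S &, injective w}.
Proof.
move=> Sm; pose W := {ffun 'I_m -> bool}.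
have Sw v : v \in S -> (index v (enum S) < size (enum W))%N.
  move=> vS; rewrite -cardE card_ffun card_bool card_ord.
  by apply: leq_trans Sm; rewrite cardE index_mem mem_enum.
exists (fun v => nth [ffun=> false] (enum W) (index v (enum S))).
move=> u v uS vS /eqP; rewrite nth_uniq ?Sw ?enum_uniq // => /eqP uv.
by apply: (index_inj u) uv; rewrite mem_enum.
Qed.

Section Coordinates.
Variables (R : realType) (G : sgraph) (S : {set G}).

Definition cut_by := forall u v : G, edge u v -> (u \in S) != (v \in S).

(** The middle value 1 puts every vertex outside [S] at distance exactly 1 from
    every vertex of [S], while the two values on [S] are more than 1 apart. *)
Definition bit_coord m (w : G -> {ffun 'I_m -> bool}) (j : 'I_m) (v : G) : R :=
  if v \in S then (if w v j then 2 else 0) else 1.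

(** Up to the shift by 1, only the signed gap [l v i - r u i] from the interval
    of [u] in [S] to that of [v] outside [S] is seen, so a single order of the
    two intervals is detected. *)
Definition box_coord k (l r : G -> 'I_k -> R) (i : 'I_k) (v : G) : R :=
  if v \in S then r v i else 1 + l v i.

Lemma bit_coord_edge m (w : G -> {ffun 'I_m -> bool}) j u v :
  cut_by -> edge u v -> `|bit_coord w j u - bit_coord w j v| <= 1.
Proof.
move=> cutS /cutS; rewrite /bit_coord ler_norml.
by do 2![case: (_ \in S)] => //= _; case: (w _ j); lra.
Qed.

Lemma bit_coord_sep m (w : G -> {ffun 'I_m -> bool}) u v :
  {in S &, injective w} -> u \in S -> v \in S -> u != v ->
  exists j, 1 < `|bit_coord w j u - bit_coord w j v|.
Proof.
move=> w_inj uS vS uv.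
have [j wj] : exists j, w u j != w v j.
  apply/existsP; apply: contraNT uv => /existsPn ww.
  by apply/eqP/w_inj => //; apply/ffunP => j; apply/eqP; have := ww j; rewrite negbK.
exists j; rewrite /bit_coord uS vS lter_normr; move: wj.
by case: (w u j); case: (w v j) => //= _; apply/orP; [left|right]; lra.
Qed.

(** On an edge the two intervals meet, so the coordinate of the vertex outside
    [S] exceeds the other one by at most 1; the bound 1/2 on the endpoints keeps
    the difference at least 0. *)
Lemma box_coord_edge k (l r : G -> 'I_k -> R) i u v : cut_by ->
  (forall v i, `|l v i| <= 2^-1) -> (forall v i, `|r v i| <= 2^-1) ->
  (l u i <= r v i) && (l v i <= r u i) -> edge u v -> `|box_coord l r i u - box_coord l r i v| <= 1.
Proof.
move=> cutS lsmall rsmall near euv; have := near; have := cutS _ _ euv.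
have := lsmall u i; have := lsmall v i; have := rsmall u i; have := rsmall v i.
rewrite /box_coord !ler_norml.
by do 2![case: (_ \in S)] => //=; lra.
Qed.

Lemma box_coord_sep k (l r : G -> 'I_k -> R) i u v :
  u \in S -> v \notin S -> r u i < l v i ->
  1 < `|box_coord l r i u - box_coord l r i v|.
Proof.
move=> uS vS ruv; rewrite /box_coord uS (negbTE vS) lter_normr.
by apply/orP; right; lra.
Qed.

Lemma cut_independent : cut_by -> independent S.
Proof.
move=> cutS; apply/forall_inP => u uS; apply/forall_inP => v vS.
by apply: contraPN uS => /cutS; rewrite vS; case: (u \in S).
Qed.

End Coordinates.

(* up_log 2 m is the least e with m <= 2 ^ e, i.e. the ceiling of log_2 m. *)
Theorem corollary4 (R : realType) (G : sgraph)
    (G_nonempty : (0 < #|G|)%N) (G_bipartite : bipartite G) :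
  (cubicity R G <= 2 * (boxicity R G + up_log 2 (alpha G)))%N.
Proof.
have [A cutA] := G_bipartite.
rewrite /cubicity; case: ex_minnP => c _; apply.
rewrite /boxicity; case: ex_minnP => k /asboolP /box_rep_small.
move=> [l [r [lsmall rsmall lrP]]] _; set m := up_log 2 _.
pose side (s : bool) := if s then A else ~: A.
have in_side s v : (v \in side s) = ((v \in A) == s).
  by case: s; rewrite /side ?inE; case: (v \in A).
have cut_side s : cut_by (side s).
  by move=> u v /cutA; rewrite !in_side; case: s; do 2!case: (_ \in A).
have words s : exists w : G -> {ffun 'I_m -> bool}, {in side s &, injective w}.
  apply: ex_binary_words; apply: leq_trans (up_logP _ _) => //.
  exact/card_le_alpha/cut_independent.
have [w w_inj] := choice words.
(* The boolean selects the side that plays the role of [S]. *)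
pose x (t : bool * ('I_k + 'I_m)) : G -> R :=
  match t.2 with
  | inl i => box_coord (side t.1) l r i
  | inr j => bit_coord R (side t.1) (w t.1) j
  end.
have -> : (2 * (k + m) = #|{: bool * ('I_k + 'I_m)}|)%N.
  by rewrite card_prod card_sum card_bool !card_ord.
apply/asboolP; apply: (cube_rep_of_coords (x := x)) => u v uv.
split=> [euv [s [i|j]]|near].
- by apply: box_coord_edge => //; exact: (lrP u v uv).1 euv i.
- exact: bit_coord_edge.
have side_u : u \in side (u \in A) by rewrite in_side.
have side_v : v \in side (v \in A) by rewrite in_side.
have [same|diff] := eqVneq (u \in A) (v \in A).
  rewrite same in side_u.
  have [j] := bit_coord_sep R (w_inj _) side_u side_v uv.
  by rewrite ltNge (near (v \in A, inr j)).
(* The endpoints are on two sides. In a direction where their intervals are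
   disjoint, the coordinate separating them belongs to the side of the vertex
   whose interval ends first. *)
have vNu : v \notin side (u \in A) by rewrite in_side eq_sym.
have uNv : u \notin side (v \in A) by rewrite in_side.
apply/lrP => // i; rewrite !leNgt; apply/andP; split; apply/negP => sep.
  have := box_coord_sep side_v uNv sep.
  by rewrite ltNge distrC (near (v \in A, inl i)).
have := box_coord_sep side_u vNu sep.
by rewrite ltNge (near (u \in A, inl i)).
Qed.
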